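(* Let $X_1,\dots,X_n$ be independent and identically distributed random variables with absolutely continuous distribution function $F$, with order statistics $X_{1:n}\le\cdots\le X_{n:n}$, and let $1\le r\le n$. Let $0<t_1<t_2$ with $F(t_1)<F(t_2)$ (so that the conditioning event has positive probability). Put $$D=\sum_{i=r}^{n}\binom{n}{i}\left[F(t_2)^i(1-F(t_2))^{n-i}-F(t_1)^i(1-F(t_1))^{n-i}\right],$$ $$S=\sum_{i=r-1}^{n-1}\binom{n-1}{i}\left[F(t_2)^{i}(1-F(t_2))^{n-1-i}-F(t_1)^{i}(1-F(t_1))^{n-1-i}\right].$$ Then for every real $x$, $$P\{X_1\le x\mid t_1\le X_{r:n}\le t_2\}=\begin{cases} D^{-1}F(x)S, & x\le t_1,\\[1mm] D^{-1}\left[F(x)S+\binom{n-1}{r-1}(F(x)-F(t_1))F(t_1)^{r-1}(1-F(t_1))^{n-r}\right], & t_1\le x\le t_2,\\[1mm] D^{-1}\left[F(x)S-\binom{n-1}{r-1}\left\{(F(x)-F(t_2))F(t_2)^{r-1}(1-F(t_2))^{n-r}-(F(x)-F(t_1))F(t_1)^{r-1}(1-F(t_1))^{n-r}\right\}\right], & x>t_2.\end{cases}$$ Moreover, for $1<r<n$, one has $D=I_{F(t_2)}(r,n-r+1)-I_{F(t_1)}(r,n-r+1)$ and $S=I_{F(t_2)}(r-1,n-r+1)-I_{F(t_1)}(r-1,n-r+1)$ in the formula above, and the conditional probability can also be written as $$P\{X_1\le x\mid t_1\le X_{r:n}\le t_2\}=\begin{cases} D^{-1}F(x)\left[I_{F(t_2)}(r-1,n-r+1)-I_{F(t_1)}(r-1,n-r+1)\right],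 & x<t_1,\\[1mm] D^{-1}\{F(x)I_{F(t_2)}(r-1,n-r+1)-(F(x)-F(t_1))I_{F(t_1)}(r,n-r)-F(t_1)I_{F(t_1)}(r-1,n-r+1)\}, & t_1\le x\le t_2,\\[1mm] D^{-1}\{(F(x)-F(t_2))I_{F(t_2)}(r,n-r)+F(t_2)I_{F(t_2)}(r-1,n-r+1)\\ \quad-(F(x)-F(t_1))I_{F(t_1)}(r,n-r)-F(t_1)I_{F(t_1)}(r-1,n-r+1)\}, & x>t_2.\end{cases}$$
   Context: $F(x)=P\{X_1\le x\}$; $X_{r:n}$ is the $r$th smallest value among $X_1,\dots,X_n$. For $a,b>0$ and $p\in[0,1]$, $I_p(a,b)=\frac{1}{B(a,b)}\int_0^p u^{a-1}(1-u)^{b-1}\,du$ is the (regularized) incomplete beta function, with $B(a,b)=\int_0^1u^{a-1}(1-u)^{b-1}\,du$. The convention $0^0=1$ is used. *)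

(* Defs.v *)
From HB Require Import structures.
From mathcomp Require Import all_boot all_order all_algebra.
From mathcomp Require Import all_classical all_reals all_analysis.
Set Implicit Arguments.
Unset Strict Implicit.
Unset Printing Implicit Defensive.
Import Order.TTheory GRing.Theory Num.Theory.
Import numFieldNormedType.Exports.
Local Open Scope classical_set_scope.
Local Open Scope ring_scope.

(* Product rule over every finite subfamily, for arbitrary Borel sets. *)
Definition mutually_independent (d : measure_display) (T : measurableType d)
    (R : realType) (P : probability T R) (I : finType) (X : I -> {RV P >-> R}) :
    Prop :=
  forall (J : {set I}) (B : I -> set R), (forall i, measurable (B i)) ->
    P (\bigcap_(i in [set` J]) X i @^-1` B i) =
    (\prod_(i in J) P (X i @^-1` B i))%E.

Definition identically_distributed (d : measure_display) (T : measurableType d)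
    (R : realType) (P : probability T R) (I : Type) (X : I -> {RV P >-> R}) :
    Prop :=
  forall (i j : I) (B : set R), measurable B ->
    distribution P (X i) B = distribution P (X j) B.

(* Epsilon-delta absolute continuity on the whole real line, tested on finite
   families of non-overlapping intervals ]a k, b k[. *)
Definition absolutely_continuous (R : realType) (F : R -> R) : Prop :=
  forall e : R, 0 < e -> exists2 delta : R, 0 < delta &
    forall (m : nat) (a b : 'I_m -> R),
      (forall k, a k <= b k) ->
      trivIset setT (fun k => `]a k, b k[%classic) ->
      \sum_(k < m) (b k - a k) < delta ->
      \sum_(k < m) `|F (b k) - F (a k)| < e.

(* X_{r:n}; r counts from 1, whereas nth counts from 0. *)
Definition order_stat (T : Type) (R : realType) (n : nat) (X : 'I_n -> T -> R)
    (r : nat) (w : T) : R :=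
  nth 0 (sort <=%R [seq X i w | i <- enum 'I_n]) r.-1.

Definition cond_prob (d : measure_display) (T : measurableType d)
    (R : realType) (P : probability T R) (A B : set T) : R :=
  fine (P (A `&` B)) / fine (P B).

(* The library's beta_fun only takes natural parameters; here a and b are real,
   meaningful for 0 < a and 0 < b. *)
Definition inc_beta (R : realType) (p a b : R) : R :=
  \int[lebesgue_measure]_(u in `[0, p]) (u `^ (a - 1) * (1 - u) `^ (b - 1)).

Definition reg_inc_beta (R : realType) (p a b : R) : R :=
  inc_beta p a b / inc_beta 1 a b.

(* Main.v *)
Require Import Defs.
From HB Require Import structures.
From mathcomp Require Import all_boot all_order all_algebra.
From mathcomp Require Import all_classical all_reals all_analysis.
From mathcomp Require Import ring.
Set Implicit Arguments.
Unset Strict Implicit.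
Unset Printing Implicit Defensive.
Import Order.TTheory GRing.Theory Num.Theory.
Import numFieldNormedType.Exports.
Local Open Scope classical_set_scope.
Local Open Scope ring_scope.

(** Fix the first variable X_1 and a level t. The event X_{r:n} <= t says that
    at least r of the sample points are <= t, so its joint law with X_1 is
    governed by what X_1 does and by the number of successes among the n - 1
    others, which is binomial with parameter p = F t. If X_1 <= t, then r - 1
    further successes suffice; otherwise r are needed. Writing Q_a(p) for the
    upper tail P(Bin(n - 1, p) >= a), this gives
<<
      P(X_1 <= x, X_{r:n} <= t)
        = F(min(x, t)) Q_{r-1}(F t) + (F x - F(min(x, t))) Q_r(F t).
>>
    Since F is continuous, the sample points < t1 obey the same law as the
    sample points <= t1, so subtracting the values of this expression at t1 from
    those at t2 yields the numerator of the conditional probability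
    ([prob_le_hits_below], [cond_prob_order_stat_window]). The denominator is
    the analogous difference of binomial tails of order n. The three cases
    x <= t1, t1 <= x <= t2 and t2 < x only decide which minimum is taken, and
    Q_{r-1} - Q_r is a single binomial probability, which is where the extra
    terms of the formula come from.

    The binomial law itself is obtained from a generating function: by
    independence, the probability that exactly the points indexed by J are
    successes is a product over all indices, and summing these products over
    the J of size m gives the coefficient of 'X^m in a product of linear
    polynomials ([sum_subsets_coef], [prob_hits_ge]).

    For the incomplete beta functions, a binomial tail is a polynomial in p
    whose derivative telescopes to a multiple of p^a (1 - p)^b; the fundamental
    theorem of calculus identifies it with the incomplete beta integral, and its
    value 1 at p = 1 gives the normalising constant
    ([reg_inc_beta_bernstein]). *)

(** * Binomial probabilities and their generating polynomial *)

(** The ring is arbitrary because the binomial probabilities are also used at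
    p = 'X, as polynomials to be differentiated. *)
Definition bernstein (A : comNzRingType) (m i : nat) (p : A) : A :=
  'C(m, i)%:R * (p ^+ i * (1 - p) ^+ (m - i)).

Definition bernstein_tail (A : comNzRingType) (m a : nat) (p : A) : A :=
  \sum_(a <= i < m.+1) bernstein m i p.

Lemma bernstein_small (A : comNzRingType) (m i : nat) (p : A) :
  (m < i)%N -> bernstein m i p = 0.
Proof. by move=> mi; rewrite /bernstein bin_small// mul0r. Qed.

Lemma coef_bernstein (A : comNzRingType) (m i : nat) (p : A) :
  ((p *: 'X + (1 - p)%:P) ^+ m)`_i = bernstein m i p.
Proof.
rewrite addrC exprDn coef_sum.
have -> : \sum_(j < m.+1)
    (((1 - p)%:P ^+ (m - j) * (p *: 'X) ^+ j) *+ 'C(m, j))`_i =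
    \sum_(j < m.+1 | j == i :> nat) bernstein m j p.
  rewrite [RHS]big_mkcond; apply: eq_bigr => j _.
  rewrite coefMn exprZn -rmorphXn/= mul_polyC !coefZ coefXn eq_sym /bernstein.
  case: eqP => _ /=; last by rewrite !mulr0 mul0rn.
  by rewrite mulr1 -[LHS]mulr_natl [_ ^+ _ * _]mulrC.
have [mi|im] := ltnP m i.
  rewrite bernstein_small// big_pred0// => j.
  by apply/negbTE; rewrite neq_ltn (leq_trans (ltn_ord j) mi).
rewrite (big_pred1 (inord i)) ?inordK// => j.
by rewrite /= -val_eqE/= inordK.
Qed.

Lemma bernstein_tail_split (A : comNzRingType) (m a : nat) (p : A) :
  (a <= m)%N ->
  bernstein_tail m a p = bernstein m a p + bernstein_tail m a.+1 p.
Proof. by move=> am; rewrite /bernstein_tail big_ltn. Qed.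

(** The polynomial below generates the number of successes in m + 1 independent
    trials, the first of which succeeds with weight a and fails with weight b:
    a success of that trial lowers by one what the other m trials must reach. *)
Lemma sum_coef_bernstein (A : comNzRingType) (m r : nat) (a b p : A) :
  (0 < r)%N ->
  \sum_(r <= j < m.+2)
     ((a *: 'X + b%:P) * (p *: 'X + (1 - p)%:P) ^+ m)`_j =
  a * bernstein_tail m r.-1 p + b * bernstein_tail m r p.
Proof.
case: r => // r _ /=; rewrite big_nat.
under eq_bigr => j /andP[rj _].
  rewrite mulrDl coefD -scalerAl mul_polyC !coefZ coefXM coef_bernstein.
  rewrite coef_bernstein gtn_eqF ?(leq_ltn_trans _ rj)//.
  over.
rewrite -big_nat big_split/= -!mulr_sumr big_add1/=; congr (_ + _ * _).
have [rm|mr] := leqP r.+1 m.+1.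
  by rewrite big_nat_recr//= bernstein_small// addr0.
by rewrite /bernstein_tail !big_geq// ltnW.
Qed.

(** This is the case where the first trial has the same law as the others. *)
Lemma bernstein_tailS (A : comNzRingType) (m r : nat) (p : A) : (0 < r)%N ->
  bernstein_tail m.+1 r p =
  p * bernstein_tail m r.-1 p + (1 - p) * bernstein_tail m r p.
Proof.
move=> r0; rewrite -sum_coef_bernstein// -exprS.
by apply: eq_bigr => j _; rewrite coef_bernstein.
Qed.

(** Expanding the product picks, for each i, either [a i *: 'X] or [b i], and
    the power of 'X counts how often the former was chosen. *)
Lemma sum_subsets_coef (A : comNzRingType) (I : finType) (a b : I -> A) m :
  \sum_(J : {set I} | #|J| == m) \prod_i (if i \in J then a i else b i) =
  (\prod_i (a i *: 'X + (b i)%:P))`_m.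
Proof.
rewrite bigA_distr coef_sum big_mkcond; apply: eq_bigr => J _.
have -> : \prod_i (if i \in J then a i *: 'X else (b i)%:P) =
    (\prod_i (if i \in J then a i else b i)) *: 'X^#|J| :> {poly A}.
  rewrite -sum1_card -prodrXr [X in _ *: X]big_mkcond -scaler_prod.
  apply: eq_bigr => i _.
  by case: ifP => _; rewrite ?expr1// alg_polyC.
by rewrite coefZ coefXn eq_sym; case: eqP => _ /=; rewrite ?mulr1 ?mulr0.
Qed.

Lemma sum_large_subsets_coef (A : comNzRingType) (I : finType) (a b : I -> A)
    r :
  \sum_(J : {set I} | (r <= #|J|)%N) \prod_i (if i \in J then a i else b i) =
  \sum_(r <= j < #|I|.+1) (\prod_i (a i *: 'X + (b i)%:P))`_j.
Proof.
under [RHS]eq_bigr do rewrite -sum_subsets_coef big_mkcond.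
rewrite exchange_big/= big_mkcond; apply: eq_bigr => J _.
rewrite -big_mkcond/= (eq_bigl (fun j => j == #|J|)) => [|j]; last first.
  exact: eq_sym.
by rewrite big_nat1_eq ltnS max_card andbT.
Qed.

(** * Order statistics as counts *)

Lemma count_card_ord (n : nat) (S : Type) (f : 'I_n -> S) (p : pred S) :
  count p [seq f i | i <- enum 'I_n] = #|[set i | p (f i)]%SET|.
Proof.
rewrite count_map -size_filter cardsE cardE enumT /enum_mem -enumT.
by congr size; apply: eq_filter.
Qed.

Section order_statistics.
Context (T : Type) (R : realType) (n : nat) (X : 'I_n -> T -> R).

Let sorted_sample w : sorted <=%R (sort <=%R [seq X i w | i <- enum 'I_n]).
Proof. exact: sort_le_sorted. Qed.

Let size_sample w : size (sort <=%R [seq X i w | i <- enum 'I_n]) = n.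
Proof. by rewrite size_sort size_map size_enum_ord. Qed.

Lemma order_stat_leE (r : nat) (w : T) (t : R) : (1 <= r)%N -> (r <= n)%N ->
  (order_stat X r w <= t) = (r <= #|[set i | (X i w <= t)%R]%SET|)%N.
Proof.
move=> r1 rn; rewrite -(count_card_ord (X^~ w) (fun x => x <= t)).
rewrite -(count_sort <=%R) -[in RHS](prednK r1) /order_stat.
apply/idP/idP => [|rt]; last exact: nth_count_le.
apply: contraTT; rewrite -leqNgt -ltNge => rt.
by apply: nth_count_gt; rewrite // rt size_sample prednK.
Qed.

Lemma order_stat_ltE (r : nat) (w : T) (t : R) : (1 <= r)%N -> (r <= n)%N ->
  (order_stat X r w < t) = (r <= #|[set i | (X i w < t)%R]%SET|)%N.
Proof.
move=> r1 rn; rewrite -(count_card_ord (X^~ w) (fun x => x < t)).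
rewrite -(count_sort <=%R) -[in RHS](prednK r1) /order_stat.
apply/idP/idP => [|rt]; last exact: nth_count_lt.
apply: contraTT; rewrite -leqNgt -leNgt => rt.
by apply: nth_count_ge; rewrite // rt size_sample prednK.
Qed.

End order_statistics.

(** * The number of sample points in a Borel set *)

Section hits.
Context (d : measure_display) (T : measurableType d) (R : realType).
Context (P : probability T R) (n : nat) (X : 'I_n -> {RV P >-> R}).

Definition hits (B : set R) (w : T) : {set 'I_n} :=
  [set i | X i w \in B]%SET.

(** In this form the event is an intersection of one event per variable, to
    which independence applies. *)
Lemma hits_eqE (B : set R) (J : {set 'I_n}) :
  [set w | hits B w = J] = \bigcap_(i in [set` [set: 'I_n]%SET])
    (X i @^-1` (if i \in J then B else ~` B)).
Proof.
apply/seteqP; split=> w /=.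
  move=> <- i _ /=; rewrite inE.
  case: ifP => [/set_mem//|/negbT/negP h] Bw.
  by apply: h; exact: mem_set.
move=> h; apply/setP => i; have := h i; rewrite /= !inE => /(_ isT).
by case: ifP => _; [move=> ?; rewrite mem_set|move=> ?; rewrite memNset].
Qed.

Lemma probability_setD (A B : set T) : measurable A -> measurable B ->
  B `<=` A -> P (A `\` B) = (P A - P B)%E.
Proof.
move=> mA mB BA; rewrite -[in RHS](setIidr BA); apply: measureD => //.
by rewrite -ge0_fin_numE// (fin_num_measure P).
Qed.

Lemma measurable_preimage_RV (i : 'I_n) (B : set R) : measurable B ->
  measurable (X i @^-1` B).
Proof.
by move=> mB; rewrite -[X in measurable X]setTI; exact: measurable_funP.
Qed.

Lemma measurable_hits_eq (B : set R) (J : {set 'I_n}) : measurable B ->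
  measurable [set w | hits B w = J].
Proof.
move=> mB; rewrite hits_eqE; apply: fin_bigcap_measurable => // i _.
by apply: measurable_preimage_RV; case: ifP => _//; exact: measurableC.
Qed.

Lemma hits_ge_bigcup (B : set R) (A : set T) (r : nat) :
  A `&` [set w | (r <= #|hits B w|)%N] =
  \bigcup_(J in [set J : {set 'I_n} | (r <= #|J|)%N])
    (A `&` [set w | hits B w = J]).
Proof.
apply/seteqP; split=> w /=; first by case=> Aw rw; exists (hits B w).
by case=> J /= rJ [Aw ->].
Qed.

Lemma measurable_hits_ge (B : set R) (r : nat) : measurable B ->
  measurable [set w | (r <= #|hits B w|)%N].
Proof.
move=> mB; rewrite -[X in measurable X]setTI hits_ge_bigcup.
apply: fin_bigcup_measurable => // J _; rewrite setTI.
exact: measurable_hits_eq.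
Qed.

Lemma prob_hits_eq (k : 'I_n) (B C : set R) (J : {set 'I_n}) :
  mutually_independent X -> measurable B -> measurable C ->
  P (X k @^-1` C `&` [set w | hits B w = J]) =
  (\prod_i P (X i @^-1` ((if i == k then C else setT) `&`
                       (if i \in J then B else ~` B))))%E.
Proof.
move=> indep mB mC.
have -> : X k @^-1` C `&` [set w | hits B w = J] =
    \bigcap_(i in [set` [set: 'I_n]%SET])
      (X i @^-1` ((if i == k then C else setT) `&`
                 (if i \in J then B else ~` B))).
  rewrite hits_eqE; apply/seteqP; split=> w /=.
    by move=> [Cw h] i iT; split; [case: eqP => // ->|exact: h].
  move=> h; split; last by move=> i iT; case: (h i iT).
  by have /= := h k; rewrite eqxx inE => /(_ isT)[].
rewrite indep => [|i].
  by apply: eq_bigl => i; rewrite inE.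
by apply: measurableI; case: ifP => // _; exact: measurableC.
Qed.

(** The index k plays the distinguished trial: it counts with weight
    P(X_k in C, X_k in B) = a when it hits B and with weight
    P(X_k in C, X_k not in B) = c - a when it misses, while every other variable
    is an ordinary trial of parameter p. *)
Lemma prob_hits_ge (k : 'I_n) (B C : set R) (r : nat) (a c p : R) :
  mutually_independent X -> measurable B -> measurable C -> (0 < r)%N ->
  P (X k @^-1` C) = c%:E -> P (X k @^-1` (C `&` B)) = a%:E ->
  (forall i, P (X i @^-1` B) = p%:E) ->
  P (X k @^-1` C `&` [set w | (r <= #|hits B w|)%N]) =
  (a * bernstein_tail n.-1 r.-1 p + (c - a) * bernstein_tail n.-1 r p)%:E.
Proof.
move=> indep mB mC r0 PkC PkCB PB.
have PkCNB : P (X k @^-1` (C `\` B)) = (c - a)%:E.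
  rewrite (_ : _ @^-1` _ = X k @^-1` C `\` X k @^-1` (C `&` B)).
    rewrite probability_setD ?PkC ?PkCB//.
    - exact: measurable_preimage_RV.
    - by apply: measurable_preimage_RV; exact: measurableI.
    - by move=> w [].
  by apply/seteqP; split => w /=; tauto.
have PNB i : P (X i @^-1` (~` B)) = (1 - p)%:E.
  rewrite preimage_setC probability_setC ?PB//.
  exact: measurable_preimage_RV.
(* f and g are the weights of a hit and of a miss of each variable. *)
pose f i := if i == k then a else p.
pose g i := if i == k then c - a else 1 - p.
have n0 : (0 < n)%N by exact: leq_ltn_trans (ltn_ord k).
rewrite hits_ge_bigcup measure_fin_bigcup//=; first last.
- move=> J _; apply: measurableI; first exact: measurable_preimage_RV.
  exact: measurable_hits_eq.
- by move=> J K _ _ [w [[_ <-] [_ <-]]].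
rewrite -(@bigfs _ _ _ _ (index_enum {set 'I_n}) (fun J => r <= #|J|)%N)//;
  first last.
- by move=> J _; rewrite mem_index_enum.
- exact: index_enum_uniq.
transitivity (\sum_(J : {set 'I_n} | (r <= #|J|)%N)
    (\prod_i (if i \in J then f i else g i))%:E)%E.
  apply: eq_bigr => J _; rewrite prob_hits_eq// -prodEFin.
  apply: eq_bigr => i _; rewrite /f /g.
  by case: eqP => [->|_]; case: ifP => _; rewrite ?setTI// -?setDE.
rewrite sumEFin sum_large_subsets_coef card_ord.
rewrite -sum_coef_bernstein//.
congr EFin; rewrite prednK//; apply: eq_bigr => j _; congr (polyseq _)`_j.
rewrite (bigD1 k)//= /f /g eqxx; congr (_ * _).
under eq_bigr => i /negbTE -> do [].
by rewrite prodr_const cardC1 card_ord.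
Qed.

End hits.

(** * Incomplete beta functions as binomial tails *)

Lemma deriv_bernsteinS (A : comNzRingType) (m i : nat) : (i <= m)%N ->
  (bernstein m.+1 i.+1 ('X : {poly A}))^`() =
  m.+1%:R * (bernstein m i 'X - bernstein m i.+1 'X).
Proof.
move=> im.
have d1X : (1 - 'X : {poly A})^`() = - 1.
  by rewrite derivB derivX -(polyC1 A) derivC sub0r.
rewrite /bernstein [X in X^`()]mulr_natl derivMn -[LHS]mulr_natl.
rewrite mulrBr 2![m.+1%:R * (_ * _)]mulrA -!natrM.
rewrite mul_bin_diag (mul_bin_down m.+1) !subSS derivM derivXn deriv_exp.
rewrite d1X/= subnS.
rewrite -[_ *+ i.+1]mulr_natl -[_ *+ (m - i)]mulr_natl !natrM; ring.
Qed.

(** The derivatives of the summands are differences of consecutive binomial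
    probabilities of order m, so the sum telescopes to its first term. *)
Lemma deriv_bernstein_tail (A : comNzRingType) (m a : nat) : (a <= m)%N ->
  (bernstein_tail m.+1 a.+1 ('X : {poly A}))^`() = m.+1%:R * bernstein m a 'X.
Proof.
move=> am; rewrite /bernstein_tail big_add1/= raddf_sum/= big_nat.
under eq_bigr => i /andP[_ im] do rewrite deriv_bernsteinS// -opprB.
rewrite -big_nat -mulr_sumr sumrN telescope_sumr ?(leq_trans am)//.
by rewrite bernstein_small// sub0r opprK.
Qed.

Lemma horner_bernstein (A : comNzRingType) (m i : nat) (p : A) :
  (bernstein m i 'X).[p] = bernstein m i p.
Proof. by rewrite /bernstein -polyC_natr !hornerE. Qed.

Lemma horner_bernstein_tail (A : comNzRingType) (m a : nat) (p : A) :
  (bernstein_tail m a 'X).[p] = bernstein_tail m a p.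
Proof.
rewrite /bernstein_tail horner_sum.
by apply: eq_bigr => i _; exact: horner_bernstein.
Qed.

Lemma bernstein_tail0 (A : comNzRingType) (m a : nat) : (0 < a)%N ->
  bernstein_tail m a (0 : A) = 0.
Proof.
move=> a0; rewrite /bernstein_tail big_nat big1// => i /andP[ai _].
by rewrite /bernstein expr0n gtn_eqF ?(leq_trans a0)// mul0r mulr0.
Qed.

Lemma bernstein_tail1 (A : comNzRingType) (m a : nat) : (a <= m)%N ->
  bernstein_tail m a (1 : A) = 1.
Proof.
move=> am; rewrite /bernstein_tail big_nat_recr//= big_nat big1 => [|i].
  by rewrite /bernstein binn subnn !expr1n expr0 !mulr1 add0r.
move=> /andP[_ im].
by rewrite /bernstein subrr expr0n subn_eq0 leqNgt im/= !mulr0.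
Qed.

Section incomplete_beta.
Context (R : realType).

(** The right-hand side is a polynomial primitive of u^a (1 - u)^b that vanishes
    at 0; the parameters are shifted so that the real powers in the integrand
    are natural powers. *)
Lemma inc_beta_bernstein (a b : nat) (p : R) : 0 <= p -> p <= 1 ->
  inc_beta p a.+1%:R b.+1%:R =
  ((a + b).+1%:R * 'C(a + b, a)%:R)^-1 * bernstein_tail (a + b).+1 a.+1 p.
Proof.
move=> p0 p1; rewrite /inc_beta /Rintegral.
set c := _ * _%:R.
have c0 : c != 0 by rewrite mulf_neq0// pnatr_eq0// -lt0n bin_gt0 leq_addr.
pose H : {poly R} := c^-1 *: bernstein_tail (a + b).+1 a.+1 'X.
have HE x : H.[x] = c^-1 * bernstein_tail (a + b).+1 a.+1 x.
  by rewrite hornerZ horner_bernstein_tail.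
have dH : H^`() = 'X^a * (1 - 'X) ^+ b.
  rewrite derivZ deriv_bernstein_tail ?leq_addr// /bernstein addKn.
  by rewrite mulrA -!polyC_natr -polyCM mul_polyC scalerA mulVf// scale1r.
transitivity (fine (\int[lebesgue_measure]_(u in `[0, p]) (H^`().[u])%:E)).
  congr fine; apply: eq_integral => u; rewrite inE/= in_itv/= => /andP[u0 up].
  rewrite -!natr1 !addrK !powR_mulrn ?subr_ge0 ?(le_trans up)//.
  by rewrite dH !hornerE.
(* The fundamental theorem needs a nondegenerate interval; both sides vanish
   at p = 0. *)
have [->|pN0] := eqVneq p 0.
  by rewrite set_itv1 integral_set1 bernstein_tail0// mulr0.
rewrite (@continuous_FTC2 _ _ (horner H)).
- by rewrite -EFinB/= !HE bernstein_tail0// mulr0 subr0.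
- by rewrite lt_def pN0.
- by apply: continuous_subspaceT => x; exact: continuous_horner.
- split.
  + by move=> x _; exact: derivable_horner.
  + by apply: cvg_at_right_filter; exact: continuous_horner.
  + by apply: cvg_at_left_filter; exact: continuous_horner.
- by move=> x _; rewrite -derivE.
Qed.

Lemma reg_inc_beta_bernstein (a b : nat) (p : R) : (0 < a)%N -> (0 < b)%N ->
  0 <= p <= 1 ->
  reg_inc_beta p a%:R b%:R = bernstein_tail (a + b).-1 a p.
Proof.
case: a b => [//|a] [//|b] _ _ /andP[p0 p1].
rewrite /reg_inc_beta !inc_beta_bernstein// addSn addnS/=.
rewrite bernstein_tail1 ?ltnS ?leq_addr// mulr1 mulrC mulKf//.
by rewrite invr_neq0// mulf_neq0// pnatr_eq0// -lt0n bin_gt0 leq_addr.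
Qed.

End incomplete_beta.

(** * Conditioning on an order statistic of an i.i.d. sample *)

(** The test family is the single interval ]t - delta / 2, t[. *)
Lemma absolutely_continuous_left (R : realType) (F : R -> R) (t e : R) :
  absolutely_continuous F -> 0 < e -> exists2 s : R, s < t & `|F t - F s| < e.
Proof.
move=> acF /acF[delta delta0 acFe].
exists (t - delta / 2); first by rewrite ltrBlDr ltrDl divr_gt0.
have := acFe 1%N (fun=> t - delta / 2) (fun=> t).
rewrite !big_ord1; apply.
- by move=> _; rewrite gerBl divr_ge0// ltW.
- by move=> i j _ _ _; rewrite !ord1.
- by rewrite subKr ltr_pdivrMr// ltr_pMr// ltr1n.
Qed.

Section iid_sample.
Context (d : measure_display) (T : measurableType d) (R : realType).
Context (P : probability T R) (n : nat) (X : 'I_n -> {RV P >-> R}).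
Context (k : 'I_n) (F : R -> R).
Hypothesis indepX : mutually_independent X.
Hypothesis idX : identically_distributed X.
Hypothesis cdfX : forall x : R, cdf (X k) x = (F x)%:E.
Hypothesis acF : absolutely_continuous F.

Lemma prob_sample_le (i : 'I_n) (t : R) : P (X i @^-1` `]-oo, t]) = (F t)%:E.
Proof. by rewrite -cdfX; exact: (idX i k (measurable_itv _)). Qed.

(** P(X_i < t) is at least F s for every s < t, and F s comes arbitrarily close
    to F t, so there is no atom at t. *)
Lemma prob_sample_lt (i : 'I_n) (t : R) : P (X i @^-1` `]-oo, t[) = (F t)%:E.
Proof.
have m_le s := measurable_preimage_RV X i (measurable_itv `]-oo, s]).
have m_lt s := measurable_preimage_RV X i (measurable_itv `]-oo, s[).
apply/eqP; rewrite eq_le; apply/andP; split.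
  rewrite -(prob_sample_le i); apply: le_measure; rewrite ?inE//.
  by move=> w /=; rewrite !in_itv/=; exact: ltW.
apply/lee_addgt0Pr => e e0.
have [s st Fts] := absolutely_continuous_left t acF e0.
apply: (@le_trans _ _ ((F s)%:E + e%:E)%E).
  by rewrite -EFinD lee_fin -lerBlDl (le_trans (ler_norm _))// ltW.
rewrite leeD2r// -(prob_sample_le i); apply: le_measure; rewrite ?inE//.
by move=> w /=; rewrite !in_itv/= => /le_lt_trans; apply.
Qed.

Lemma cdf_itv01 (t : R) : 0 <= F t <= 1.
Proof.
rewrite -!lee_fin -(prob_sample_le k) measure_ge0/=.
by apply: probability_le1; exact: measurable_preimage_RV.
Qed.

(** One family for both kinds of half-lines, because the event
    t1 <= X_{r:n} <= t2 needs the closed one at t2 and the open one at t1: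
    [strict] tells whether t itself is left out. *)
Definition below (strict : bool) (t : R) : set R :=
  [set` Interval -oo%O (BSide strict t)].

Lemma measurable_below strict (t : R) : measurable (below strict t).
Proof. exact: measurable_itv. Qed.

Lemma prob_sample_below (i : 'I_n) strict (t : R) :
  P (X i @^-1` below strict t) = (F t)%:E.
Proof. by case: strict; [exact: prob_sample_lt|exact: prob_sample_le]. Qed.

Lemma hits_below_le (t : R) (w : T) :
  hits X (below false t) w = [set i | X i w <= t]%SET.
Proof. by apply/setP => i; rewrite !inE /below mem_setE in_itv. Qed.

Lemma hits_below_lt (t : R) (w : T) :
  hits X (below true t) w = [set i | X i w < t]%SET.
Proof. by apply/setP => i; rewrite !inE /below mem_setE in_itv. Qed.

(** The joint law of X_k and of the number of sample points below t comes from
    [prob_hits_ge] with C = ]-oo, x]. Whether t belongs to the half-line does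
    not change the probabilities, hence a single formula. *)
Lemma prob_le_hits_below (r : nat) strict (x t : R) : (0 < r)%N ->
  P (X k @^-1` `]-oo, x] `&` [set w | (r <= #|hits X (below strict t) w|)%N]) =
  (F (Num.min x t) * bernstein_tail n.-1 r.-1 (F t) +
   (F x - F (Num.min x t)) * bernstein_tail n.-1 r (F t))%:E.
Proof.
move=> r0; apply: prob_hits_ge => //.
- exact: measurable_below.
- exact: prob_sample_le.
- have [xt|tx] := ltP x t.
    rewrite -(prob_sample_le k); congr (P (X k @^-1` _)).
    apply/seteqP; split => y /=; rewrite /below/= !in_itv/=; first by case.
    move=> yx; split => //; have := le_lt_trans yx xt.
    by case: strict => //= /ltW.
  rewrite -(prob_sample_below k strict); congr (P (X k @^-1` _)).
  apply/seteqP; split => y /=; rewrite /below/= !in_itv/=; first by case.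
  move=> yt; split => //; apply: le_trans tx.
  by case: strict yt => //= /ltW.
- by move=> i; exact: prob_sample_below.
Qed.

Lemma prob_hits_below (r : nat) strict (t : R) : (0 < r)%N ->
  P [set w | (r <= #|hits X (below strict t) w|)%N] =
  (bernstein_tail n r (F t))%:E.
Proof.
move=> r0; have n0 : (0 < n)%N by exact: leq_ltn_trans (ltn_ord k).
rewrite -[X in P X]setTI -(preimage_setT (X k)).
rewrite (@prob_hits_ge _ _ _ _ _ _ _ _ _ _ (F t) 1 (F t))//.
- by rewrite -bernstein_tailS// prednK.
- exact: measurable_below.
- exact: (probability_setT P).
- by rewrite setTI prob_sample_below.
- by move=> i; exact: prob_sample_below.
Qed.

Context (r : nat) (t1 t2 : R).
Hypotheses (r_ge1 : (1 <= r)%N) (r_le_n : (r <= n)%N) (lt_t12 : t1 < t2).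

Let E := [set w | t1 <= order_stat X r w <= t2].
Let upper := [set w | (r <= #|hits X (below false t2) w|)%N].
Let lower := [set w | (r <= #|hits X (below true t1) w|)%N].

(** X_{r:n} <= t2 means at least r points <= t2, and t1 <= X_{r:n} fails exactly
    when at least r points are < t1. *)
Lemma order_stat_windowE : E = upper `\` lower.
Proof.
apply/seteqP; split => w; rewrite /E /upper /lower /=;
  rewrite hits_below_le hits_below_lt.
  rewrite (order_stat_leE X w t2 r_ge1 r_le_n) leNgt.
  by rewrite (order_stat_ltE X w t1 r_ge1 r_le_n) => /andP[/negP].
rewrite (order_stat_leE X w t2 r_ge1 r_le_n) leNgt.
by rewrite (order_stat_ltE X w t1 r_ge1 r_le_n) => -[-> /negP ->].
Qed.

Lemma sub_lower_upper : lower `<=` upper.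
Proof.
move=> w; rewrite /lower /upper/= => /leq_trans; apply; apply: subset_leq_card.
apply/fintype.subsetP => i.
rewrite hits_below_le hits_below_lt !inE/= => /lt_trans-/(_ _ lt_t12).
exact: ltW.
Qed.

Lemma measurable_order_stat_window : measurable E.
Proof.
by rewrite order_stat_windowE; apply: measurableD;
  apply: measurable_hits_ge; exact: measurable_itv.
Qed.

Lemma prob_order_stat_window_with (A : set T) : measurable A ->
  fine (P (A `&` E)) = fine (P (A `&` upper)) - fine (P (A `&` lower)).
Proof.
move=> mA; have mU : measurable (A `&` upper).
  by apply: measurableI => //; apply: measurable_hits_ge; exact: measurable_itv.
have mL : measurable (A `&` lower).
  by apply: measurableI => //; apply: measurable_hits_ge; exact: measurable_itv.
have -> : A `&` E = (A `&` upper) `\` (A `&` lower).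
  rewrite order_stat_windowE; apply/seteqP; split => w /=.
    by move=> [Aw [Uw Lw]]; split=> // -[].
  by move=> [[Aw Uw] Lw]; split=> //; split=> // Lw'; exact: Lw.
rewrite probability_setD//; last exact: setIS sub_lower_upper.
by rewrite fineB// (fin_num_measure P).
Qed.

(** If all sample points lie in ]t1, t2], then so does X_{r:n}; this has
    probability (F t2 - F t1)^n. *)
Lemma prob_order_stat_window_gt0 : F t1 < F t2 -> (0 < P E)%E.
Proof.
move=> F12.
have PI i : P (X i @^-1` `]t1, t2]) = (F t2 - F t1)%:E.
  rewrite EFinB -!(prob_sample_le i) -probability_setD.
  - congr (P _); apply/seteqP; split => w /=; rewrite !in_itv/=.
      by move=> /andP[t1w ->]; split=> //; apply/negP; rewrite -ltNge.
    by move=> [-> /negP]; rewrite -ltNge => ->.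
  - exact: measurable_preimage_RV.
  - exact: measurable_preimage_RV.
  - by move=> w /=; rewrite !in_itv/= => /le_trans; apply; exact: ltW.
have mI i : measurable (X i @^-1` `]t1, t2]) by exact: measurable_preimage_RV.
have := indepX [set: 'I_n]%SET (fun=> measurable_itv `]t1, t2]).
under eq_bigr do rewrite PI.
rewrite prodEFin => PcapE.
apply: (@lt_le_trans _ _ (\prod_(i in [set: 'I_n]%SET) (F t2 - F t1))%:E).
  by rewrite lte_fin prodr_gt0// => i _; rewrite subr_gt0.
rewrite -PcapE; apply: le_measure; rewrite ?inE.
- exact: fin_bigcap_measurable.
- exact: measurable_order_stat_window.
move=> w /= Iw; rewrite order_stat_windowE /upper /lower; split => /=.
  rewrite (_ : hits _ _ _ = [set: 'I_n]%SET) ?cardsT ?card_ord//.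
  apply/setP => i; rewrite hits_below_le !inE/=.
  by have := Iw i (finset.in_setT i); rewrite /= in_itv/= => /andP[].
rewrite (_ : hits _ _ _ = finset.set0) ?cards0; first by case: r r_ge1.
apply/setP => i; rewrite hits_below_lt !inE/=; apply/negbTE; rewrite -leNgt.
by have := Iw i (finset.in_setT i); rewrite /= in_itv/= => /andP[/ltW].
Qed.

Lemma cond_prob_order_stat_window (x : R) :
  let Q a t := bernstein_tail n.-1 a (F t) in
  let G t := F (Num.min x t) * Q r.-1 t + (F x - F (Num.min x t)) * Q r t in
  cond_prob P [set w | X k w <= x] E =
  (bernstein_tail n r (F t2) - bernstein_tail n r (F t1))^-1 * (G t2 - G t1).
Proof.
move=> Q G; rewrite /cond_prob mulrC; congr (_^-1 * _).
  rewrite -[E]setTI prob_order_stat_window_with// !setTI.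
  by rewrite !prob_hits_below.
have -> : [set w | X k w <= x] = X k @^-1` `]-oo, x].
  by apply/seteqP; split => w /=; rewrite in_itv.
rewrite prob_order_stat_window_with; last exact: measurable_preimage_RV.
by rewrite !prob_le_hits_below.
Qed.

End iid_sample.

Theorem theorem2 (R : realType) (d : measure_display) (T : measurableType d)
    (P : probability T R) (n r : nat) (r_ge1 : (1 <= r)%N) (r_le_n : (r <= n)%N)
    (X : 'I_n -> {RV P >-> R}) (F : R -> R) (t1 t2 : R) :
  let X1 : {RV P >-> R} := X (Ordinal (leq_trans r_ge1 r_le_n)) in
  mutually_independent X ->
  identically_distributed X ->
  (forall x : R, cdf X1 x = (F x)%:E) ->
  absolutely_continuous F ->
  0 < t1 -> t1 < t2 -> F t1 < F t2 ->
  let E : set T := [set w | t1 <= order_stat X r w <= t2] in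
  let D : R := \sum_(r <= i < n.+1) 'C(n, i)%:R *
    (F t2 ^+ i * (1 - F t2) ^+ (n - i) - F t1 ^+ i * (1 - F t1) ^+ (n - i)) in
  let S : R := \sum_(r.-1 <= i < n) 'C(n.-1, i)%:R *
    (F t2 ^+ i * (1 - F t2) ^+ (n.-1 - i)
     - F t1 ^+ i * (1 - F t1) ^+ (n.-1 - i)) in
  let Pcond (x : R) : R := cond_prob P [set w | X1 w <= x] E in
  let I (p a b : R) : R := reg_inc_beta p a b in
  let rR : R := r%:R in
  let nR : R := n%:R in
  [/\ (0 < P E)%E,
      forall x : R,
        [/\ x <= t1 -> Pcond x = D^-1 * (F x * S),
            t1 <= x <= t2 ->
              Pcond x = D^-1 * (F x * S + 'C(n.-1, r.-1)%:R *
                ((F x - F t1) * F t1 ^+ r.-1 * (1 - F t1) ^+ (n - r))) &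
            t2 < x ->
              Pcond x = D^-1 * (F x * S - 'C(n.-1, r.-1)%:R *
                ((F x - F t2) * F t2 ^+ r.-1 * (1 - F t2) ^+ (n - r)
                 - (F x - F t1) * F t1 ^+ r.-1 * (1 - F t1) ^+ (n - r)))] &
      (1 < r < n)%N ->
        [/\ D = I (F t2) rR (nR - rR + 1) - I (F t1) rR (nR - rR + 1),
            S = I (F t2) (rR - 1) (nR - rR + 1)
                - I (F t1) (rR - 1) (nR - rR + 1) &
            forall x : R,
              [/\ x < t1 ->
                    Pcond x = D^-1 * (F x * (I (F t2) (rR - 1) (nR - rR + 1)
                                       - I (F t1) (rR - 1) (nR - rR + 1))),
                  t1 <= x <= t2 ->
                    Pcond x = D^-1 * (F x * I (F t2) (rR - 1) (nR - rR + 1)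
                      - (F x - F t1) * I (F t1) rR (nR - rR)
                      - F t1 * I (F t1) (rR - 1) (nR - rR + 1)) &
                  t2 < x ->
                    Pcond x = D^-1 * ((F x - F t2) * I (F t2) rR (nR - rR)
                      + F t2 * I (F t2) (rR - 1) (nR - rR + 1)
                      - (F x - F t1) * I (F t1) rR (nR - rR)
                      - F t1 * I (F t1) (rR - 1) (nR - rR + 1))]]].
Proof.
move=> X1 indepX idX cdfX acF t1_gt0 lt_t12 ltF12 E D S Pcond I rR nR.
pose Q a t := bernstein_tail n.-1 a (F t).
have n_gt0 : (0 < n)%N := leq_trans r_ge1 r_le_n.
have nK : n.-1.+1 = n by exact: prednK.
have DE : D = bernstein_tail n r (F t2) - bernstein_tail n r (F t1).
  rewrite /D /bernstein_tail -sumrB; apply: eq_bigr => i _.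
  by rewrite /bernstein mulrBr.
have SE : S = Q r.-1 t2 - Q r.-1 t1.
  rewrite /S /Q /bernstein_tail nK -sumrB; apply: eq_bigr => i _.
  by rewrite /bernstein mulrBr.
(* The first term of the tail Q_{r-1} is the binomial probability of r - 1. *)
have QE t : Q r.-1 t =
    'C(n.-1, r.-1)%:R * (F t ^+ r.-1 * (1 - F t) ^+ (n - r)) + Q r t.
  rewrite /Q bernstein_tail_split; last by rewrite -!subn1 leq_sub2r.
  by rewrite /bernstein prednK// -!subn1 subnBA// subnK.
have F01 t := cdf_itv01 idX cdfX t.
(* G x t is the probability of X_1 <= x and X_{r:n} <= t. *)
pose G x t := F (Num.min x t) * Q r.-1 t + (F x - F (Num.min x t)) * Q r t.
have PcondE x : Pcond x = D^-1 * (G x t2 - G x t1).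
  by rewrite DE; exact: cond_prob_order_stat_window.
have Pcond_low x : x <= t1 -> Pcond x = D^-1 * (F x * S).
  move=> xt1; have xt2 := le_trans xt1 (ltW lt_t12).
  rewrite PcondE /G !min_l// SE; congr (_ * _); ring.
have Pcond_mid x : t1 <= x <= t2 -> Pcond x =
    D^-1 * (F x * Q r.-1 t2 - (F x - F t1) * Q r t1 - F t1 * Q r.-1 t1).
  move=> /andP[t1x xt2].
  by rewrite PcondE /G (min_l xt2) (min_r t1x); congr (_ * _); ring.
have Pcond_high x : t2 < x -> Pcond x =
    D^-1 * ((F x - F t2) * Q r t2 + F t2 * Q r.-1 t2
            - (F x - F t1) * Q r t1 - F t1 * Q r.-1 t1).
  move=> t2x; have t1x := lt_trans lt_t12 t2x.
  by rewrite PcondE /G (min_r (ltW t2x)) (min_r (ltW t1x)); congr (_ * _); ring.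
split.
- exact: (prob_order_stat_window_gt0 indepX idX cdfX).
- move=> x; split=> hx; first exact: Pcond_low.
  + by rewrite Pcond_mid// SE !QE; congr (_ * _); ring.
  + by rewrite Pcond_high// SE !QE; congr (_ * _); ring.
move=> /andP[r_gt1 r_lt_n].
have r1E : rR - 1 = r.-1%:R by rewrite /rR -subn1 natrB.
have nrE : nR - rR = (n - r)%:R by rewrite natrB.
have nr1E : nR - rR + 1 = (n - r).+1%:R by rewrite nrE natr1.
have r1_gt0 : (0 < r.-1)%N by rewrite -subn1 subn_gt0.
have I_D t : I (F t) rR (nR - rR + 1) = bernstein_tail n r (F t).
  by rewrite nr1E /I reg_inc_beta_bernstein// addnS subnKC.
have I_S t : I (F t) (rR - 1) (nR - rR + 1) = Q r.-1 t.
  rewrite nr1E r1E /I reg_inc_beta_bernstein// addnS -addSn prednK//.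
  by rewrite subnKC.
have I_Q t : I (F t) rR (nR - rR) = Q r t.
  by rewrite nrE /I reg_inc_beta_bernstein ?subn_gt0// subnKC.
split; [by rewrite !I_D DE|by rewrite !I_S SE|move=> x].
rewrite !I_S !I_Q; split=> hx.
- by rewrite Pcond_low ?ltW// SE.
- exact: Pcond_mid.
- exact: Pcond_high.
Qed.
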